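(* Let $P$ denote a (real-valued, square-integrable) functional of the solution of the SPDE in the context for a given Brownian path $W$, and, for each level $l=0,1,2,\dots$, let $\hat P_l$ denote the corresponding level-$l$ numerical approximation. Let $h\in(0,1)$ be fixed. Suppose that there exist independent estimators $\hat Y_l$ ($l\ge0$), $\hat Y_l$ being based on $N_l$ Monte Carlo samples, and positive constants $\alpha,\beta,\gamma,c_1,c_2,c_3$ such that for all $l$ and all $N_l\ge1$: (i) $|\mathbb{E}[\hat P_l-P]|\le c_1h^{\alpha l}$; (ii) $\mathbb{E}[\hat Y_0]=\mathbb{E}[\hat P_0]$, and $\mathbb{E}[\hat Y_l]=\mathbb{E}[\hat P_l-\hat P_{l-1}]$ for $l>0$; (iii) $\mathrm{var}(\hat Y_l)\le c_2N_l^{-1}h^{\beta l}$; (iv) $C_l\le c_3N_lh^{-\gamma l}$, where $C_l$ is the computational complexity of $\hat Y_l$. If $0<\beta<\gamma$, then there exists a positive constant $c_4$ such that for every $\varepsilon\in(0,1)$ there are values of $L$ and $N_0,\dots,N_L$ for which the multilevel estimator $$\hat Y=\sum_{l=0}^L\hat Y_l$$ has mean-square error $$\mathbb{E}\left[\left(\hat Y-\mathbb{E}[P]\right)^2\right]<\varepsilon^2$$ and computational complexity $C=\sum_{l=0}^LC_l$ satisfying $$C\le c_4\left(\varepsilon^{-2-\frac{\gamma-\beta}{\alpha}}+\varepsilon^{-\frac\gamma\alpha}\right).$$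
   Context: The SPDE is the degenerate Langevin equation $d_{\mathbf Y}u_t(x,v)=\frac{a_t(x,v)}2\partial_{vv}u_t(x,v)\,dt+\sigma_t(x,v)\,\partial_vu_t(x,v)\,dW_t$, $\mathbf Y=\partial_t+v\partial_x$, driven by a Brownian motion $W$; only the properties (i)-(iv) of the approximations $\hat P_l$ and of the estimators $\hat Y_l$ are used. The computational complexity $C_l$ is a nonnegative number (the cost of computing $\hat Y_l$ with $N_l$ samples), and the cost of $\hat Y$ is the sum of the costs of the $\hat Y_l$. For each $l$ and each integer $N_l\ge1$ an estimator $\hat Y_l$ with $N_l$ samples is available; $L\ge0$ and the $N_l\ge1$ are integers. The constant $c_4$ does not depend on $\varepsilon$. *)

(* Defs.v *)
From HB Require Import structures.
From mathcomp Require Export all_boot all_order all_algebra finmap.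
From mathcomp Require Export all_classical all_reals all_analysis.
Export Order.TTheory GRing.Theory Num.Theory.
Export numFieldNormedType.Exports.

Set Implicit Arguments.
Unset Strict Implicit.
Unset Printing Implicit Defensive.

Local Open Scope classical_set_scope.
Local Open Scope ring_scope.

(* Mutual (not merely pairwise) independence of an arbitrary family of real
   random variables: the product rule over every finite subfamily. *)
Definition mutually_independent (d : measure_display) (T : measurableType d)
    (R : realType) (PP : probability T R) (I : choiceType)
    (X : I -> {RV PP >-> R}) : Prop :=
  forall (J : {fset I}) (A : I -> set R),
    (forall i, i \in J -> measurable (A i)) ->
    PP (\bigcap_(i in [set` J]) (X i @^-1` A i)) =
    (\prod_(i <- J) PP (X i @^-1` A i))%E.

(* Main.v *)
Require Import Defs.
From mathcomp Require Import measurable_realfun ring lra.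

(* The bias is independent of the sample sizes, because the level means telescope
   to [E[Phat L]]; so the mean-square error is the variance of the sum, i.e. the
   sum of the level variances, plus the squared bias. Take [L] minimal with bias
   at most [eps / 2] and, with [x = h^((gamma - beta)/2)], let [N l] be [K l]
   rounded up, where [K l] is proportional to the square root of (variance per
   sample / cost per sample) at level [l], scaled so that the variances add up to
   at most [eps^2 / 2]. The cost coming from [K l] is then geometric in
   [h^(-(gamma - beta))] and the cost coming from rounding is geometric in
   [h^(-gamma)]; minimality of [L] bounds [h^(-alpha L)] by a multiple of
   [1 / eps]. *)

Local Open Scope classical_set_scope.
Local Open Scope ring_scope.

Set Implicit Arguments.
Unset Strict Implicit.
Unset Printing Implicit Defensive.

(** * Integrability from a finite mean or variance *)

Section expectation_extra.
Context d (T : measurableType d) (R : realType) (PP : probability T R).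
Local Open Scope ereal_scope.

(* Without integrability of [X] the integral is the difference of the integrals of
   the positive and negative parts with [+oo - +oo = -oo], so it is never finite. *)
Lemma fin_num_expectation_Lfun1 (X : T -> R) : measurable_fun [set: T] X ->
  'E_PP[X] \is a fin_num -> X \in Lfun PP 1.
Proof.
move=> mX; rewrite unlock integralE fin_numB => /andP[fp fn].
have mE : measurable_fun [set: T] (fun x => (X x)%:E).
  exact/measurable_EFinP.
apply/Lfun1_integrable/integrableP; split => //.
rewrite (_ : (fun x => `|(EFin \o X) x|) =
    (fun x => (EFin \o X)^\+ x + (EFin \o X)^\- x)); last first.
  by rewrite -[RHS]/((EFin \o X)^\+ \+ (EFin \o X)^\-) -fune_abse.
rewrite ge0_integralD//; last 2 first.
- exact: measurable_funepos.
- exact: measurable_funeneg.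
by rewrite lte_add_pinfty// ltey_eq ?fp ?fn.
Qed.

(** The variance is centred at the [fine] of the mean, which is a real number in every case; its
    finiteness therefore puts [X] minus a constant, and so [X], in L2. *)
Lemma lty_variance_Lfun2 (X : T -> R) : measurable_fun [set: T] X ->
  'V_PP[X] < +oo -> X \in Lfun PP 2%:E.
Proof.
move=> mX; rewrite /variance unlock => VX.
set m := fine 'E_PP[X] in VX.
have mY : measurable_fun [set: T] (X \- cst m)%R.
  exact: measurable_funB.
have -> : X = ((X \- cst m) + cst m)%R by apply/funext => w; rewrite !fctE subrK.
rewrite rpredD ?lee1n//=; last by move=> ?; exact: Lfun_cst.
move=> _; apply/andP; split; rewrite inE//=/finite_norm.
rewrite unlock /=; apply: poweR_lty.
apply: le_lt_trans VX; rewrite expectation.unlock.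
by under eq_integral do rewrite powR_mulrn// real_normK ?num_real// expr2.
Qed.

End expectation_extra.

(** * Independence, variance of sums and mean-square error *)

Lemma mutually_independent_covariance0 (d : measure_display)
    (T : measurableType d) (R : realType) (PP : probability T R)
    (I : choiceType) (X : I -> {RV PP >-> R}) (i j : I) :
  mutually_independent X -> i != j ->
  (X i : T -> R) \in Lfun PP 2%:E -> (X j : T -> R) \in Lfun PP 2%:E ->
  covariance PP (X i) (X j) = 0%E.
Proof.
move=> indep ij Xi2 Xj2.
have Pfin : PP setT \is a fin_num := fin_num_measure PP _ measurableT.
have Xi1 := Lfun_subset12 Pfin Xi2.
have Xj1 := Lfun_subset12 Pfin Xj2.
have XX1 := Lfun2_mul_Lfun1 Xi2 Xj2.
rewrite covarianceE//.
(* The joint law of [X i] and [X j] is the product of their laws; apply Fubini. *)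
pose Z w := (X i w, X j w).
have mZ : measurable_fun [set: T] Z by exact/measurable_fun_pair.
pose f (z : R * R) := (z.1 * z.2)%:E.
have mf : measurable_fun [set: R * R] f.
  by apply/measurable_EFinP; exact: measurable_funM.
pose mu := distribution PP (X i); pose nu := distribution PP (X j).
have jointE A : measurable A -> (mu \x nu)%E A = pushforward PP Z A.
  (* The product measure is determined by measurable rectangles, where the product rule over
     [{i, j}] applies. *)
  apply: (product_measure_unique (m1 := mu) (m2 := nu)).
  move=> B C mB mC.
  pose S k := if k == i then B else C.
  have := indep [fset i; j]%fset S.
  rewrite big_fsetU1/= ?inE// big_seq_fset1 /S eqxx eq_sym (negbTE ij).
  have -> : \bigcap_(k in [set` [fset i; j]%fset])
      (X k @^-1` (if k == i then B else C)) = Z @^-1` (B `*` C).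
    apply/seteqP; split => w /=.
      move=> H; split => /=.
        by have := H i; rewrite /= !inE eqxx; exact.
      by have := H j; rewrite /= !inE eqxx orbT eq_sym (negbTE ij); exact.
    move=> [Bw Cw] k /=; rewrite !inE => /orP[] /eqP ->.
      by rewrite eqxx.
    by rewrite eq_sym (negbTE ij).
  by apply => k _; case: ifP.
have intf : PP.-integrable [set: T] (f \o Z) by exact/Lfun1_integrable.
have joint_int (g : R * R -> \bar R) :
    (\int[(mu \x nu)%E]_z g z = \int[pushforward PP Z]_z g z)%E.
  by apply: eq_measure_integral => A mA _; exact: jointE.
have intfp : (mu \x nu)%E.-integrable [set: R * R] f.
  have /integrableP[_ foo] := integrable_pushforward mZ mf intf measurableT.
  by apply/integrableP; split => //; rewrite joint_int.
have XjE : (\int[nu]_y y%:E = 'E_PP[X j])%E.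
  rewrite integral_distribution//; last exact/Lfun1_integrable.
  by rewrite unlock.
have XiE : (\int[mu]_y y%:E = 'E_PP[X i])%E.
  rewrite integral_distribution//; last exact/Lfun1_integrable.
  by rewrite unlock.
have intj : nu.-integrable [set: R] EFin.
  apply: integrable_pushforward => //; exact/Lfun1_integrable.
have inti : mu.-integrable [set: R] EFin.
  apply: integrable_pushforward => //; exact/Lfun1_integrable.
have -> : ('E_PP[X i * X j] = 'E_PP[X i] * 'E_PP[X j])%E.
  transitivity (\int[pushforward PP Z]_z f z)%E.
    by rewrite integral_pushforward// unlock.
  rewrite -joint_int -integral12_prod_meas1//=.
  rewrite -[in RHS](fineK (expectation_fin_num Xj1)) -XiE -integralZr//.
  apply: eq_integral => x _; rewrite /f /fubini_F/=.
  under eq_integral do rewrite EFinM.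
  by rewrite integralZl// XjE fineK// expectation_fin_num.
by rewrite subee// fin_numM// expectation_fin_num.
Qed.

Lemma variance_sum_independent (d : measure_display) (T : measurableType d)
    (R : realType) (PP : probability T R) (X : nat -> {RV PP >-> R}) (n : nat) :
  mutually_independent X -> (forall i, (X i : T -> R) \in Lfun PP 2%:E) ->
  'V_PP[(fun w => \sum_(i < n) X i w)%R]%E = (\sum_(i < n) 'V_PP[X i])%E.
Proof.
move=> indep X2.
pose S m : T -> R := fun w => \sum_(i < m) X i w.
have S0 : S 0%N = cst 0 by apply/funext => w; rewrite /S big_ord0.
have SS m : S m.+1 = (S m \+ X m)%R.
  by apply/funext => w; rewrite /S big_ord_recr.
have S2 m : S m \in Lfun PP 2%:E.
  elim: m => [|m IH]; first by rewrite S0 Lfun_cst.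
  by rewrite SS rpredD// lee1n.
(* [m <= k] keeps [k] apart from every index summed in [S m]. *)
have covS m k : (m <= k)%N -> covariance PP (S m) (X k) = 0%E.
  elim: m => [|m IH] mk; first by rewrite S0 covariance_cst_l.
  rewrite SS covarianceDl// IH 1?ltnW// add0e.
  by apply: mutually_independent_covariance0 => //; rewrite ltn_eqF.
elim: n => [|n IH]; first by rewrite -/(S 0%N) S0 variance_cst big_ord0.
by rewrite -/(S n.+1) SS varianceD// covS// mule0 adde0 big_ord_recr/= -IH.
Qed.

(** Bias-variance decomposition: subtracting [c] shifts the mean but not the variance. *)
Lemma mean_square_errorE (d : measure_display) (T : measurableType d)
    (R : realType) (PP : probability T R) (X : T -> R) (c : R) :
  X \in Lfun PP 2%:E ->
  ('E_PP[(fun w => (X w - c) ^+ 2)%R] =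
   'V_PP[X] + ((fine 'E_PP[X] - c) ^+ 2)%:E)%E.
Proof.
move=> X2.
have Pfin : PP setT \is a fin_num := fin_num_measure PP _ measurableT.
have X1 := Lfun_subset12 Pfin X2.
have Y2 : (X \- cst c)%R \in Lfun PP 2%:E.
  by rewrite rpredB ?lee1n//= => _; exact: Lfun_cst.
rewrite -(varianceB_cst_r c)// varianceE//.
rewrite expectationB ?Lfun_cst// expectation_cst.
rewrite -(fineK (expectation_fin_num X1)) -EFinB/= -expr2 EFinN subeK//.
Qed.

(** * Geometric sums and the truncation level *)

(** Reversing the summation leaves the largest term times a geometric sum of ratio [x]. *)
Lemma sum_exprVn_le (R : realFieldType) (x : R) (n : nat) : 0 < x < 1 ->
  \sum_(l < n.+1) x ^- l <= x ^- n / (1 - x).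
Proof.
move=> /andP[x0 x1]; have x1' : 0 < 1 - x by rewrite subr_gt0.
have -> : \sum_(l < n.+1) x ^- l = x ^- n * \sum_(l < n.+1) x ^+ l.
  rewrite mulr_sumr (reindex_inj rev_ord_inj)/=.
  apply: eq_bigr => l _; have lL : (l <= n)%N by rewrite -ltnS.
  by rewrite subSS exprB ?unitfE ?gt_eqF// invfM invrK mulrC.
apply: ler_wpM2l; first by rewrite invr_ge0 exprn_ge0// ltW.
rewrite -[leRHS]div1r ler_pdivlMr//.
rewrite mulrC -opprB mulNr -subrX1 opprB lerBlDr lerDl exprn_ge0// ltW//.
Qed.

(** Take the least [L]. If it is positive, the first bound fails at [L - 1], which yields
    [2 * c / q]; the summand [1] covers [L = 0], where [eps < 1] is used. *)
Lemma exists_truncation_level (R : archiRealFieldType) (q c eps : R) :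
  0 < q < 1 -> 0 < c -> 0 < eps < 1 ->
  exists L : nat, c * q ^+ L <= eps / 2 /\ q ^- L <= (1 + 2 * c / q) / eps.
Proof.
move=> /andP[q0 q1] c0 /andP[e0 e1].
have c0' := ltW c0; have q0' := ltW q0.
have exL : exists L, c * q ^+ L <= eps / 2.
  have /cvgrPdist_lt/(_ (eps / 2 / c)) : (q ^+ n @[n --> \oo] --> (0 : R)).
    by apply: cvg_expr; rewrite ger0_norm.
  rewrite !divr_gt0// => /(_ isT)[n _ /(_ n (leqnn n))].
  rewrite /= sub0r normrN ger0_norm ?exprn_ge0// ltr_pdivlMr// mulrC => /ltW.
  by exists n.
case: (ex_minnP exL) => -[|L] HL minL; [exists 0%N|exists L.+1]; split=> //.
  rewrite expr0 invr1 ler_pdivlMr// mul1r (le_trans (ltW e1))// lerDl.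
  by rewrite divr_ge0// mulr_ge0.
have : eps / 2 < c * q ^+ L.
  by rewrite ltNge; apply/negP => /minL; rewrite ltnn.
rewrite ltr_pdivrMr// => H.
rewrite ler_pdivlMr// mulrC ler_pdivrMr ?exprn_gt0//.
rewrite [leRHS](_ : _ = q ^+ L.+1 + c * q ^+ L * 2); last first.
  by rewrite exprS; field; rewrite gt_eqF.
by rewrite (le_trans (ltW H))// lerDr exprn_ge0.
Qed.

(** With [t = alpha], this turns the growth of cost into powers of the one quantity that the
    truncation level controls. *)
Lemma powR_exprVn (R : realType) (a s t : R) (n : nat) : 0 <= a -> t != 0 ->
  (a `^ s) ^- n = ((a `^ t) ^- n) `^ (s / t).
Proof.
move=> a0 t0; rewrite -!powR_invn ?powR_ge0// -!powRrM.
by congr (_ `^ _); field.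
Qed.

(** * Choice of the level and of the sample sizes *)

(** The deterministic half of the argument. [N] is given at every level because independence is
    assumed for whole sequences of sample sizes. *)
Lemma multilevel_parameters (R : realType)
    (h alpha beta gamma c1 c2 c3 : R) :
  0 < h < 1 -> 0 < alpha -> 0 < gamma -> 0 < c1 -> 0 < c2 -> 0 < c3 ->
  beta < gamma ->
  exists2 c4 : R, 0 < c4 &
    forall eps : R, 0 < eps < 1 ->
      exists (L : nat) (N : nat -> nat),
        [/\ forall l, (1 <= N l)%N,
            c1 * h `^ (alpha * L%:R) <= eps / 2,
            \sum_(l < L.+1) c2 * (N l)%:R^-1 * h `^ (beta * l%:R)
              <= eps ^+ 2 / 2
          & \sum_(l < L.+1) c3 * (N l)%:R * h `^ (- (gamma * l%:R)) <=
              c4 * (eps `^ (- 2 - (gamma - beta) / alpha)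
                    + eps `^ (- (gamma / alpha)))].
Proof.
move=> /andP[h0 h1] a0 g0 c10 c20 c30 bg.
have powlt1 (s : R) : 0 < s -> 0 < h `^ s < 1.
  move=> s0; rewrite powR_gt0//= -[ltRHS](congr1 (@^~ s) (powR1 R)).
  by rewrite gt0_ltr_powR// nnegrE ltW.
(* Ratios per level of the bias, the variance and the inverse cost; [x] below is the square root of
   [g / b]. *)
pose q := h `^ alpha; pose b := h `^ beta; pose g := h `^ gamma.
pose x := h `^ ((gamma - beta) / 2).
have q01 : 0 < q < 1 by exact: powlt1.
have g01 : 0 < g < 1 by exact: powlt1.
have x01 : 0 < x < 1 by apply: powlt1; rewrite divr_gt0// subr_gt0.
have b0 : 0 < b by exact: powR_gt0.
have /andP[x0 x1] := x01; have /andP[g0' g1] := g01.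
have x1' : 0 < 1 - x by rewrite subr_gt0.
have g1' : 0 < 1 - g by rewrite subr_gt0.
have x2E : x ^+ 2 = h `^ (gamma - beta).
  by rewrite -powR_mulrn ?powR_ge0// -powRrM divfK.
have gE : g = b * x ^+ 2.
  rewrite x2E -powRD ?(gt_eqF h0) ?implybT//.
  by congr (_ `^ _); rewrite addrC subrK.
have bE l : h `^ (beta * l%:R) = b ^+ l.
  by rewrite powRrM powR_mulrn// powR_ge0.
have gEl l : h `^ (- (gamma * l%:R)) = g ^- l.
  by rewrite powRN powRrM powR_mulrn// powR_ge0.
have qE l : h `^ (alpha * l%:R) = q ^+ l.
  by rewrite powRrM powR_mulrn// powR_ge0.
have xq l : x ^- l * x ^- l = (q ^- l) `^ ((gamma - beta) / alpha).
  rewrite -invfM -exprD addnn -mul2n exprM x2E.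
  by apply: powR_exprVn; [exact: ltW|exact: lt0r_neq0].
have gq l : g ^- l = (q ^- l) `^ (gamma / alpha).
  by apply: powR_exprVn; [exact: ltW|exact: lt0r_neq0].
clearbody q b g x.
(* [M / eps] is the bound on [q ^- L] that the truncation level provides. *)
pose M := 1 + 2 * c1 / q.
have /andP[q0 q1] := q01.
have M0 : 0 < M by rewrite addr_gt0// divr_gt0// mulr_gt0.
pose k1 := 2 * c2 / (1 - x) ^+ 2 * M `^ ((gamma - beta) / alpha).
pose k2 := M `^ (gamma / alpha) / (1 - g).
have k10 : 0 < k1.
  by rewrite mulr_gt0 ?powR_gt0// divr_gt0 ?exprn_gt0// mulr_gt0.
have k20 : 0 < k2 by rewrite divr_gt0// powR_gt0.
exists (c3 * (k1 + k2)); last move=> eps e01.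
  by rewrite mulr_gt0// addr_gt0.
have [L [Lbias LM]] := exists_truncation_level q01 c10 e01.
have /andP[e0 e1] := e01.
(* Solves [c2 / (A * (1 - x)) = eps ^+ 2 / 2], the variance budget. *)
pose A := 2 * c2 / eps ^+ 2 / (1 - x).
have A0 : 0 < A by rewrite !divr_gt0// ?mulr_gt0// exprn_gt0.
(* [(b * x) ^+ l] is the square root of [b ^+ l * g ^+ l], and [x ^- L] offsets the size of the
   geometric sum of the variances. *)
pose K l := A * x ^- L * (b * x) ^+ l.
have KE l : K l = A * x ^- L * (b * x) ^+ l by [].
have AE : A = 2 * c2 / eps ^+ 2 / (1 - x) by [].
have K0 l : 0 < K l.
  by rewrite !mulr_gt0// ?invr_gt0 ?exprn_gt0// mulr_gt0.
clearbody K A.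
(* The successor of the integer part is positive, exceeds [K l], and is at most [K l + 1]. *)
exists L, (fun l => (Num.truncn (K l)).+1); split => [//|||].
- by rewrite qE.
- have leK (l : nat) : c2 * (Num.truncn (K l)).+1%:R^-1 * h `^ (beta * l%:R) <=
      c2 / (A * x ^- L) * x ^- l.
    rewrite bE.
    rewrite (_ : _ * x ^- l = c2 * (K l)^-1 * b ^+ l); last first.
      by rewrite KE exprMn; field; rewrite !expf_neq0 ?gt_eqF.
    apply: ler_wpM2r; first by rewrite exprn_ge0// ltW.
    apply: ler_wpM2l; first exact: ltW.
    rewrite lef_pV2 ?posrE//.
    exact/ltW/truncnS_gt.
  apply: (le_trans (ler_sum _ (fun (l : 'I_L.+1) _ => leK l))).
  rewrite -mulr_sumr.
  apply: (le_trans (ler_wpM2l _ (sum_exprVn_le L x01))).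
    by rewrite divr_ge0 ?mulr_ge0 ?invr_ge0 ?exprn_ge0// ltW.
  rewrite le_eqVlt; apply/orP; left; apply/eqP; rewrite AE; field.
  by rewrite !expf_neq0 ?gt_eqF//= ?exprn_gt0.
(* As [g = b * x ^+ 2], the [K l] part costs a multiple of [x ^- l]; rounding up costs at most
   [c3 * g ^- l]. *)
have leK (l : nat) : c3 * (Num.truncn (K l)).+1%:R * h `^ (- (gamma * l%:R)) <=
    c3 * (A * x ^- L) * x ^- l + c3 * g ^- l.
  rewrite gEl.
  rewrite [leRHS](_ : _ = c3 * (K l + 1) * g ^- l); last first.
    rewrite KE gE !exprMn; field; rewrite !expf_neq0 ?gt_eqF//.
  apply: ler_wpM2r; first by rewrite invr_ge0 exprn_ge0// ltW.
  apply: ler_wpM2l; first exact: ltW.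
  rewrite -natr1 lerD2r.
  by have /andP[] := truncn_itv (ltW (K0 l)).
apply: (le_trans (ler_sum _ (fun (l : 'I_L.+1) _ => leK l))).
rewrite big_split/= -!mulr_sumr.
have powM (s : R) : 0 < s -> (q ^- L) `^ s <= M `^ s * eps `^ (- s).
  have e0' := ltW e0; have M0' := ltW M0; have q0' := ltW q0.
  move=> s0; rewrite -[- s]mulN1r powRrM powR_inv1// -powRM ?invr_ge0//.
  apply: ge0_ler_powR; rewrite ?nnegrE ?invr_ge0 ?exprn_ge0 ?divr_ge0//.
  exact: ltW.
have gba0 : 0 < (gamma - beta) / alpha by rewrite divr_gt0// subr_gt0.
have ga0 : 0 < gamma / alpha by rewrite divr_gt0.
have U := powM _ gba0; have V := powM _ ga0.
rewrite -xq in U; rewrite -gq in V.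
have -> : eps `^ (- 2 - (gamma - beta) / alpha) =
    eps ^- 2 * eps `^ (- ((gamma - beta) / alpha)).
  by rewrite powRD ?(gt_eqF e0) ?implybT// powR_invn// ltW.
set u := eps `^ _ in U *; set v := eps `^ _ in V *.
have u0 : 0 < u by exact: powR_gt0.
have v0 : 0 < v by exact: powR_gt0.
(* The sum brings a second factor [x ^- L]; by [xq] their product is a power of [q ^- L], bounded
   through [u], while [A] supplies [eps ^- 2]. *)
have cost1 : c3 * (A * x ^- L) * (\sum_(l < L.+1) x ^- l) <=
    c3 * k1 * (eps ^- 2 * u).
  apply: (le_trans (ler_wpM2l _ (sum_exprVn_le L x01))).
    by rewrite !mulr_ge0 ?invr_ge0 ?exprn_ge0// ltW.
  rewrite [leLHS](_ : _ = c3 * A / (1 - x) * (x ^- L * x ^- L)); last first.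
    by field; rewrite !expf_neq0 ?gt_eqF.
  rewrite [leRHS](_ : _ =
      c3 * A / (1 - x) * (M `^ ((gamma - beta) / alpha) * u)); last first.
    by rewrite AE /k1; field; rewrite !gt_eqF.
  by rewrite ler_wpM2l// divr_ge0 ?mulr_ge0// ltW.
have cost2 : c3 * (\sum_(l < L.+1) g ^- l) <= c3 * k2 * v.
  rewrite -mulrA ler_pM2l//; apply: (le_trans (sum_exprVn_le L g01)).
  by rewrite /k2 mulrAC ler_pM2r ?invr_gt0.
clearbody k1 k2; apply: (le_trans (lerD cost1 cost2)).
have e2u : 0 < eps ^- 2 * u by rewrite mulr_gt0// invr_gt0 exprn_gt0.
(* The larger side only adds nonnegative cross terms. *)
rewrite -2!(mulrA c3) -mulrDr -mulrA ler_pM2l// mulrDl !mulrDr.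
by apply: lerD; rewrite ?lerDl ?lerDr mulr_ge0// ltW.
Qed.

(** * Error and cost of the multilevel estimator *)

Theorem theorem4p1 (d : measure_display) (T : measurableType d) (R : realType)
    (PP : probability T R)
    (P : {RV PP >-> R})
    (Phat : nat -> {RV PP >-> R})
    (Yhat : nat -> nat -> {RV PP >-> R}) (* [Yhat l N]: level [l], [N] samples *)
    (C : nat -> nat -> R)                (* [C l N]: cost of [Yhat l N] *)
    (h alpha beta gamma c1 c2 c3 : R) :
  (P : T -> R) \in Lfun PP 2%:E ->
  (forall l N : nat, (1 <= N)%N -> 0 <= C l N) ->
  0 < h < 1 ->
  0 < alpha -> 0 < beta -> 0 < gamma -> 0 < c1 -> 0 < c2 -> 0 < c3 ->
  (forall N : nat -> nat, (forall l, (1 <= N l)%N) ->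
    mutually_independent (fun l => Yhat l (N l))) ->
  (forall l : nat,
    (`| 'E_PP[(fun w => Phat l w - P w)%R] | <= (c1 * h `^ (alpha * l%:R))%:E)%E) ->
  (forall N : nat, (1 <= N)%N -> 'E_PP[Yhat 0%N N]%E = 'E_PP[Phat 0%N]%E) ->
  (forall l N : nat, (0 < l)%N -> (1 <= N)%N ->
    'E_PP[Yhat l N]%E = 'E_PP[(fun w => Phat l w - Phat l.-1 w)%R]%E) ->
  (forall l N : nat, (1 <= N)%N ->
    ('V_PP[Yhat l N] <= (c2 * N%:R^-1 * h `^ (beta * l%:R))%:E)%E) ->
  (forall l N : nat, (1 <= N)%N ->
    C l N <= c3 * N%:R * h `^ (- (gamma * l%:R))) ->
  beta < gamma ->
  exists2 c4 : R, 0 < c4 &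
    forall eps : R, 0 < eps < 1 ->
      exists (L : nat) (N : 'I_L.+1 -> nat),
        [/\ forall l, (1 <= N l)%N,
            ('E_PP[(fun w => (\sum_(l < L.+1) Yhat l (N l) w
                              - fine 'E_PP[P]) ^+ 2)%R] < (eps ^+ 2)%:E)%E
          & \sum_(l < L.+1) C l (N l) <=
              c4 * (eps `^ (- 2 - (gamma - beta) / alpha)
                    + eps `^ (- (gamma / alpha)))].
Proof.
move=> P2 C_ge0 h01 a0 b0 g0 c10 c20 c30 indep bias meanY0 meanY varY costY bg.
have [c4 c40 params] := multilevel_parameters h01 a0 g0 c10 c20 c30 bg.
exists c4 => // eps e01.
have [L [N [N1 biasL varL costL]]] := params _ e01.
exists L, (fun l => N l); split => //; last first.
  by apply: le_trans costL; apply: ler_sum => l _; exact: costY.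
have Pfin : PP setT \is a fin_num := fin_num_measure PP _ measurableT.
have P1 := Lfun_subset12 Pfin P2.
(* Integrability of [Phat l] is extracted from the bias bound, which makes the mean of [Phat l - P]
   finite. *)
have D1 l : (fun w => Phat l w - P w) \in Lfun PP 1.
  apply: fin_num_expectation_Lfun1; first exact: measurable_funB.
  by rewrite fin_num_abs (le_lt_trans (bias l))// ltry.
have Phat1 l : (Phat l : T -> R) \in Lfun PP 1.
  have -> : (Phat l : T -> R) = ((fun w => Phat l w - P w) \+ P)%R.
    by apply/funext => w /=; rewrite subrK.
  by rewrite rpredD.
pose Y l := Yhat l (N l).
have Y2 l : (Y l : T -> R) \in Lfun PP 2%:E.
  apply: lty_variance_Lfun2; first exact: measurable_funPT.
  by rewrite (le_lt_trans (varY _ _ (N1 l)))// ltry.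
pose S n w := \sum_(l < n) Y l w.
have SS n : S n.+1 = (S n \+ Y n)%R.
  by apply/funext => w; rewrite /S big_ord_recr.
have S2 n : S n \in Lfun PP 2%:E.
  elim: n => [|n IH]; last by rewrite SS rpredD// lee1n.
  rewrite (_ : S 0%N = cst 0) ?Lfun_cst//.
  by apply/funext => w; rewrite /S big_ord0.
(* [S n.+1] collects the levels from [0] to [n], so the telescoping ends at [Phat n]. *)
have ES n : 'E_PP[S n.+1]%E = 'E_PP[Phat n]%E.
  elim: n => [|n IH].
    rewrite -(meanY0 _ (N1 0%N)); congr expectation.
    by apply/funext => w; rewrite /S big_ord1.
  rewrite SS expectationD; last 2 first.
  - exact: Lfun_subset12.
  - exact: Lfun_subset12.
  rewrite IH /Y meanY// expectationB//= addeC subeK//.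
  exact: expectation_fin_num.
have varS : ('V_PP[S L.+1] <= (eps ^+ 2 / 2)%:E)%E.
  rewrite variance_sum_independent//; last exact: indep.
  apply: (@le_trans _ _ (\sum_(l < L.+1)
      (c2 * (N l)%:R^-1 * h `^ (beta * l%:R))%:E)%E).
    by apply: lee_sum => l _; exact: varY.
  by rewrite sumEFin lee_fin.
have biasS : `|fine 'E_PP[Phat L]%E - fine 'E_PP[P]%E| <= eps / 2.
  rewrite -fineB ?expectation_fin_num// -expectationB// -lee_fin -abse_EFin.
  rewrite fineK; last exact/expectation_fin_num/D1.
  by apply: (le_trans (bias L)); rewrite lee_fin.
rewrite (mean_square_errorE (fine 'E_PP[P]%E) (S2 L.+1)) ES.
(* The two shares are [1/2] and [1/4] of [eps ^+ 2], hence the strict inequality. *)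
apply: (@le_lt_trans _ _ (eps ^+ 2 / 2 + (eps / 2) ^+ 2)%:E).
  rewrite EFinD leeD// lee_fin -real_normK ?num_real//.
  by rewrite ler_sqr ?nnegrE// (le_trans _ biasS).
have /andP[e0 _] := e01.
by rewrite lte_fin; nra.
Qed.
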